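(* Let $T>0$, $M>0$, and let $\rho^0\in L^1_{\mu,M}(\mathbb R^d)$ be nonnegative everywhere. Let $V\colon[0,T]\times L^1_{\mu,M}(\mathbb R^d)\to\mathcal V^{\mathrm{as}}(G)$ be measurable and suppose there are constants $C_V,L_V>0$ such that, for all $t\in[0,T]$ and all $\rho,\sigma\in L^1_{\mu,M}(\mathbb R^d)$, $$\sup_{t\in[0,T]}\ \sup_{\rho\in L^1_{\mu,M}(\mathbb R^d)}\ \sup_{x\in\mathbb R^d}\int_{\mathbb R^d\setminus\{x\}}|V_t[\rho](x,y)|\,\eta(x,y)\,d\mu(y)\le C_V,$$ $$\sup_{x\in\mathbb R^d}\int_{\mathbb R^d\setminus\{x\}}|V_t[\rho](x,y)-V_t[\sigma](x,y)|\,\eta(x,y)\,d\mu(y)\le L_V\|\rho-\sigma\|_{L^1_\mu(\mathbb R^d)}.$$ Let $\Phi$ be the upwind interpolation $\Phi(a,b;w)=a\,w_+-b\,w_-$. Then the solution $\rho\in\mathrm{AC}([0,T];L^1_\mu(\mathbb R^d))$ of $\partial_t\rho+\overline\nabla\cdot F^\Phi[\mu;\rho_t,v_t]=0$ with $v_t=V_t[\rho_t]$ and $\rho_0=\rho^0$, i.e. satisfying for $\mu$-a.e. $x\in\mathbb R^d$ $$\rho_t(x)=\rho^0(x)-\int_0^t\overline\nabla\cdot F^\Phi[\mu;\rho_s,v_s](x)\,ds,$$ is nonnegative a.e., that is, $\rho_t(x)\ge0$ for a.e. $t\in[0,T]$ and $\mu$-a.e. $x\in\mathbb R^d$.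
   Context: Graph. $\mu$ is a fixed nonnegative Radon measure on $\mathbb R^d$. $\eta\colon\{(x,y)\in\mathbb R^d\times\mathbb R^d: x\neq y\}\to[0,\infty)$ is measurable, $G:=\{(x,y): x\ne y,\ \eta(x,y)>0\}$, and $\eta$ is continuous, bounded and symmetric on $G$. $\mathcal V^{\mathrm{as}}(G)$ is the set of antisymmetric functions $v\colon G\to\mathbb R$, i.e. $v(y,x)=-v(x,y)$ (expressions containing the factor $\eta$ are read as $0$ outside $G$). For $a\in\mathbb R$, $a_+=\max\{0,a\}$ and $a_-=(-a)_+$. $L^1_\mu(\mathbb R^d)$ is the space of $\mu$-integrable functions with norm $\|\rho\|_{L^1_\mu}=\int|\rho|\,d\mu$, and $L^1_{\mu,M}(\mathbb R^d)=\{\rho\in L^1_\mu(\mathbb R^d):\int_{\mathbb R^d}|\rho(x)|\,d\mu(x)=M\}$; solutions take values in $L^1_{\mu,M}(\mathbb R^d)$, where $V$ is defined. $\mathrm{AC}([0,T];L^1_\mu(\mathbb R^d))$ is the set of curves for which there is $m\in L^1([0,T])$ with $\|\rho_s-\rho_t\|_{L^1_\mu}\le\int_s^t m(r)\,dr$ for $0\le s<t\le T$. For the upwind interpolation, the nonlocal divergence of the flux has $\mu$-density $$\overline\nabla\cdot F^\Phi[\mu;\rho,w](x)=\int_{\mathbb R^d\setminus\{x\}}\big(\rho(x)\,w(x,y)_+-\rho(y)\,w(x,y)_-\big)\eta(x,y)\,d\mu(y).$$ *)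

(* Defs.v *)
From HB Require Import structures.
From mathcomp Require Import all_boot all_order all_algebra.
From mathcomp Require Import all_classical all_reals all_analysis.

Set Implicit Arguments.
Unset Strict Implicit.
Unset Printing Implicit Defensive.

Import Order.TTheory GRing.Theory Num.Theory.
Import numFieldNormedType.Exports.

Local Open Scope classical_set_scope.
Local Open Scope ring_scope.

(* R^d as a topological space with its Borel sigma-algebra.  The norm inherited
   from 'rV[R]_d is the sup norm, but only the topology is used below. *)
Definition Rd (R : realType) (d : nat) : Type := 'rV[R]_d.

HB.instance Definition _ (R : realType) (d : nat) :=
  NormedModule.copy (Rd R d) 'rV[R]_d.

HB.instance Definition _ (R : realType) (d : nat) :=
  @isMeasurable.Build (sigma_display (@open 'rV[R]_d)) (Rd R d)
    <<s @open 'rV[R]_d >> (@sigma_algebra0 _ setT (@open 'rV[R]_d))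
    (@sigma_algebraC _ (@open 'rV[R]_d))
    (@sigma_algebra_bigcup _ setT (@open 'rV[R]_d)).

Section Definitions.
Context (R : realType) (d : nat).
Local Notation X := (Rd R d).
Implicit Types (mu : {measure set X -> \bar R}) (eta w : X -> X -> R).
Implicit Types (f g : X -> R) (rho : R -> X -> R) (M T : R).

Definition radon mu : Prop :=
  (forall K : set X, compact K -> (mu K < +oo)%E) /\
  (forall A : set X, measurable A ->
     mu A = ereal_sup [set mu K | K in [set K : set X | compact K /\ K `<=` A]]).

Definition graph eta : set (X * X) :=
  [set z | z.1 <> z.2 /\ 0 < eta z.1 z.2].

(* eta is only meaningful off the diagonal: its values on the diagonal are
   never used. *)
Definition edge_weight eta : Prop :=
  [/\ forall x y, x <> y -> 0 <= eta x y,
      measurable_fun [set z : X * X | z.1 <> z.2] (fun z => eta z.1 z.2),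
      {within graph eta, continuous (fun z : X * X => eta z.1 z.2)},
      (exists C : R, forall z, graph eta z -> eta z.1 z.2 <= C) &
      forall x y, graph eta (x, y) -> eta y x = eta x y].

(* A function on G is represented by a function on X * X whose values outside G
   are irrelevant. *)
Definition antisymmetric_on_graph eta w : Prop :=
  forall x y, graph eta (x, y) -> w y x = - w x y.

Definition pos_part (a : R) : R := Num.max 0 a.
Definition neg_part (a : R) : R := pos_part (- a).

Definition upwind (a b w : R) : R := a * pos_part w - b * neg_part w.

Definition nonlocal_divergence (Phi : R -> R -> R -> R) mu eta f w (x : X) : R :=
  \int[mu]_(y in ~` [set x]) (Phi (f x) (f y) (w x y) * eta x y).

Definition L1_dist mu f g : \bar R := (\int[mu]_x (`|f x - g x|)%:E)%E.

Definition L1M mu M : set (X -> R) :=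
  [set f | mu.-integrable setT (EFin \o f) /\
           (\int[mu]_x (`|f x|)%:E)%E = M%:E].

(* The sets of functions whose trace on L1M is open for the L^1 distance. *)
Definition L1M_open mu M : set (set (X -> R)) :=
  [set U | forall f, L1M mu M f -> U f ->
     exists2 e : R, 0 < e &
       forall g, L1M mu M g -> (L1_dist mu f g < e%:E)%E -> U g].

(* Joint measurability of (t, f, x, y) |-> V t f x y on [0, T] * L1M * G, where
   L1M carries the Borel sigma-algebra of the L^1 distance. *)
Definition measurable_velocity mu eta M T
    (V : R -> (X -> R) -> X -> X -> R) : Prop :=
  measurable_fun
    ((`[0, T] `*` (L1M mu M : set (g_sigma_algebraType (L1M_open mu M))))
       `*` graph eta)
    (fun z : (R * g_sigma_algebraType (L1M_open mu M)) * (X * X) =>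
       V z.1.1 z.1.2 z.2.1 z.2.2).

Definition AC_L1 mu T rho : Prop :=
  (forall t, 0 <= t <= T -> mu.-integrable setT (EFin \o rho t)) /\
  exists2 m : R -> R,
    lebesgue_measure.-integrable `[0, T] (EFin \o m) &
    forall s t, 0 <= s -> s < t -> t <= T ->
      (L1_dist mu (rho s) (rho t) <= \int[lebesgue_measure]_(r in `[s, t]) (m r)%:E)%E.

(* Here rho t x denotes the value at x of a representative of rho_t, and the
   exceptional mu-null set of points x does not depend on t.  The integrability
   clause is what gives meaning to the time integral. *)
Definition solution (Phi : R -> R -> R -> R) mu eta M T
    (V : R -> (X -> R) -> X -> X -> R) f rho : Prop :=
  let div s x := nonlocal_divergence Phi mu eta (rho s) (V s (rho s)) x in
  [/\ AC_L1 mu T rho,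
      forall t, 0 <= t <= T -> L1M mu M (rho t) &
      {ae mu, forall x,
        lebesgue_measure.-integrable `[0, T] (fun s => (div s x)%:E) /\
        forall t, 0 <= t <= T ->
          rho t x = f x - \int[lebesgue_measure]_(s in `[0, t]) div s x}].

End Definitions.

(* Main.v *)
From HB Require Import structures.
Require Import Defs.
From mathcomp Require Import all_boot all_order all_algebra.
From mathcomp Require Import all_classical all_reals all_analysis.
From mathcomp Require Import measurable_realfun.

Import Order.TTheory GRing.Theory Num.Theory.
Import numFieldNormedType.Exports.

Local Open Scope classical_set_scope.
Local Open Scope ring_scope.

(* Let n_t be the negative part of rho_t.  Where rho_t(x) < 0, the divergence at
   x is at most int n_t(y) v_t(x,y)_- eta(x,y) dmu(y), because the outflow term
   rho_t(x) v_t(x,y)_+ is nonpositive.  Integrating in time from the last instant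
   at which rho(x) >= 0 gives
     n_t(x) <= int_0^t int n_s(y) v_s(x,y)_- eta(x,y) dmu(y) ds.
   By antisymmetry v_s(x,y)_- <= |v_s(y,x)|, so integrating in x, Tonelli and the
   bound on V yield int n_t dmu <= C_V int_0^t (int n_s dmu) ds, and Gronwall's
   argument forces n_t = 0.  Joint measurability in (s,x,y) comes from the
   L^1-continuity of s |-> rho_s and a Caratheodory argument. *)

(** * Comparison of integrals without measurability *)

(* In contrast to ge0_le_integral, no measurability is assumed: the integral of a
   nonnegative function is a supremum over the simple functions below it. *)
Lemma ge0_le_integral_nomeas {d} {T : measurableType d} {R : realType}
    (mu : {measure set T -> \bar R}) (D : set T) (f g : T -> \bar R) :
  (forall x, D x -> 0 <= f x)%E -> (forall x, D x -> f x <= g x)%E ->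
  (\int[mu]_(x in D) f x <= \int[mu]_(x in D) g x)%E.
Proof.
move=> f0 fg; have g0 x : D x -> (0 <= g x)%E.
  by move=> Dx; exact: le_trans (f0 _ Dx) (fg _ Dx).
rewrite !ge0_integralE//; apply: le_ereal_sup => _ [h hf <-].
by exists h => // x; apply: (le_trans (hf x)); exact: lee_restrict.
Qed.

(** Dropping the negative part of [f] can only raise its integral, and [f^\+ <= g] because [g] is
    nonnegative. Thus [f] may change sign. *)
Lemma le_integral_ge0_nomeas {d} {T : measurableType d} {R : realType}
    (mu : {measure set T -> \bar R}) (D : set T) (f g : T -> \bar R) :
  (forall x, D x -> 0 <= g x)%E -> (forall x, D x -> f x <= g x)%E ->
  (\int[mu]_(x in D) f x <= \int[mu]_(x in D) g x)%E.
Proof.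
move=> g0 fg; rewrite integralE.
apply: (@le_trans _ _ (\int[mu]_(x in D) f^\+ x)%E).
  by rewrite geeDl// oppe_le0 integral_ge0.
by apply: ge0_le_integral_nomeas => // x Dx; rewrite funeposE ge_max fg ?g0.
Qed.

(** * Gronwall's argument *)

Lemma integral_expR_mull {R : realType} (l t : R) : 0 < t ->
  (\int[lebesgue_measure]_(s in `[0%R, t]) (l * expR (l * s))%R%:E =
   (expR (l * t))%R%:E - 1)%E.
Proof.
move=> t0.
have dF (x : R) : is_derive x 1 (fun s => expR (l * s)) (l * expR (l * x)).
  apply: is_derive_eq.
  by rewrite /= /GRing.scale/= mulr1 mulrC.
have cF (x : R) : {for x, continuous (fun s : R => expR (l * s))}.
  apply: differentiable_continuous; apply/derivable1_diffP.
  by have := dF x => -[].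
rewrite (@continuous_FTC2 _ _ (fun s => expR (l * s)))//.
- by rewrite mulr0 expR0.
- apply: continuous_subspaceT => x; apply: cvgM; [exact: cvg_cst|exact: cF].
- split.
  + by move=> x _; have := dF x => -[].
  + by apply: cvg_at_right_filter; exact: cF.
  + by apply: cvg_at_left_filter; exact: cF.
- by move=> x _; rewrite derive1E; have := dF x => -[].
Qed.

(** The a priori bound [M] is improved by iterating the hypothesis: the successive bounds tend to 0
    at each fixed [t]. Only integrals are compared and nothing is differentiated, so [N] can be an
    arbitrary function with values in [0, M]. *)
Lemma integral_gronwall_eq0 {R : realType} (N : R -> \bar R) (T C M : R) :
  0 < C ->
  (forall t, 0 <= t <= T -> (0 <= N t <= M%:E)%E) ->
  (forall t, 0 <= t <= T ->
     (N t <= C%:E * \int[lebesgue_measure]_(s in `[0%R, t]) N s)%E) ->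
  forall t, 0 <= t <= T -> N t = 0%E.
Proof.
move=> C0 NM Nint.
have N0 t : 0 <= t <= T -> (0 <= N t)%E by move=> /NM/andP[].
have M0 t : 0 <= t <= T -> 0 <= M.
  by move=> /NM/andP[a b]; rewrite -lee_fin (le_trans a b).
(* The weight expR (2 C t) makes each use of the hypothesis halve the bound. *)
have bnd k t : 0 <= t <= T -> (N t <= (M / 2 ^+ k * expR (2 * C * t))%:E)%E.
  elim: k t => [|k IH] t /[dup] tT /andP[t0 tT'].
    have /andP[_ /le_trans] := NM _ tT; apply.
    rewrite lee_fin expr0 divr1 ler_peMr ?(M0 t)//.
    by rewrite -expR0 ler_expR mulr_ge0// mulr_ge0// ltW.
  (* The time 0 is treated apart, since the explicit integral of the weight is available only for
     [0 < t]. *)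
  move: t0; rewrite le_eqVlt => /predU1P[t0|t0].
    apply: le_trans (Nint _ tT) _.
    rewrite -t0 set_itv1 integral_set1 mule0 lee_fin mulr_ge0 ?expR_ge0//.
    by rewrite divr_ge0 ?(M0 t)// exprn_ge0.
  apply: le_trans (Nint _ tT) _.
  have Mk : 0 <= M / 2 ^+ k.+1 by rewrite divr_ge0 ?(M0 t)// exprn_ge0.
  (* The inductive bound is rewritten as a constant times [2 * C * expR (2 * C * s)], the derivative
     of the weight; the factor 2 of this derivative is what provides the halving. *)
  apply: (@le_trans _ _ (C%:E * \int[lebesgue_measure]_(s in `[0%R, t])
      ((M / 2 ^+ k.+1 / C)%:E * (2 * C * expR (2 * C * s))%:E))%E).
    rewrite lee_pmul2l// ?lte_fin//; apply: ge0_le_integral_nomeas => s /=.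
      rewrite in_itv/= => /andP[s0 st]; apply: N0.
      by rewrite s0 (le_trans st).
    rewrite in_itv/= => /andP[s0 st].
    have /IH/le_trans : 0 <= s <= T by rewrite s0 (le_trans st).
    apply; rewrite -EFinM lee_fin le_eqVlt; apply/orP; left; apply/eqP.
    rewrite exprS invfM -!mulrA; congr (M * _); set e := expR _.
    by rewrite [RHS]mulrCA; congr (_ * _); rewrite (mulrCA C^-1) !mulKf// gt_eqF.
  rewrite ge0_integralZl_EFin//=.
  - rewrite integral_expR_mull// -EFinB -!EFinM lee_fin.
    rewrite mulrA mulrCA mulfV ?gt_eqF// mulr1.
    by rewrite ler_wpM2l// lerBlDr lerDl.
  - by move=> s _; rewrite lee_fin !mulr_ge0 ?expR_ge0// ltW.
  - apply/measurable_EFinP; apply: measurable_funM => //.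
    apply: measurableT_comp; first exact: measurable_expR.
    exact: mulrl_measurable.
  - by rewrite divr_ge0 // ltW.
move=> t tT; apply/eqP; rewrite eq_le N0// andbT.
have : (fun k => (M / 2 ^+ k * expR (2 * C * t))%:E) @ \oo --> 0%:E.
  apply: cvg_EFin; first exact: nearW.
  rewrite -[X in _ --> X](mul0r (expR (2 * C * t))).
  apply: cvgMl.
  rewrite -[X in _ --> X](mulr0 M); apply: cvgMr.
  under eq_fun do rewrite -exprVn.
  by apply: cvg_expr; rewrite ger0_norm// invf_lt1// ltr1n.
by move=> lim0; apply: (cvge_ge _ lim0); near=> k; exact: bnd.
Unshelve. all: by end_near. Qed.

(** * Curves extended to the whole time line, and Carathéodory functions *)

(** For [0 <= T] this is the projection onto [0, T]. Composing with it freezes a curve at its end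
    values, so that continuity and measurability can be stated on all of R. *)
Definition clamp {R : realType} (T t : R) : R := Num.max 0 (Num.min t T).

Lemma clamp_itv {R : realType} (T t : R) : 0 <= T -> 0 <= clamp T t <= T.
Proof. by move=> T0; rewrite le_max lexx ge_max T0 ge_min lexx orbT. Qed.

Lemma clamp_id {R : realType} (T t : R) : 0 <= t <= T -> clamp T t = t.
Proof. by move=> /andP[t0 tT]; rewrite /clamp min_l// max_r. Qed.

Lemma clamp_continuous {R : realType} (T : R) : continuous (clamp T).
Proof.
move=> t; apply: (@continuous_max _ _ (cst 0) (fun s => Num.min s T)).
  exact: cvg_cst.
by apply: (@continuous_min _ _ id (cst T)); [exact: cvg_id|exact: cvg_cst].
Qed.

Lemma within_continuous_clamp {R : realType} (T : R) {Y : topologicalType}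
    (g : R -> Y) : 0 <= T -> {within `[0, T], continuous g} ->
  continuous (g \o clamp T).
Proof.
move=> T0 /subspace_continuousP gc t.
have cT u : `[0, T]%classic (clamp T u) by rewrite /= in_itv/= clamp_itv.
apply: (cvg_comp _ _ _ (gc _ (cT t))) => U /(@clamp_continuous _ T t) cU.
by apply: (@filterS _ (nbhs t) _ _ _ _ cU) => u /= /(_ (cT u)).
Qed.

(** Time is rounded down to the grid of mesh 1/(n+1). The discretized function is measurable because
    preimages are countable unions of products, one for each grid cell, and it converges pointwise
    by continuity in time. *)
Lemma caratheodory_measurable_fun {R : realType} {d} {Y : measurableType d}
    (f : R -> Y -> R) :
  (forall t, measurable_fun setT (f t)) -> (forall y, continuous (f^~ y)) ->
  measurable_fun setT (fun z : R * Y => f z.1 z.2).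
Proof.
move=> mf cf.
pose tau n (t : R) : R := (Num.floor (t * n.+1%:R))%:~R / n.+1%:R.
apply: (@measurable_fun_cvg _ _ _ _ (fun n z => f (tau n z.1) z.2)).
  move=> n _ B mB; rewrite setTI.
  rewrite (_ : _ @^-1` _ = \bigcup_(k : int)
    ((`[k%:~R / n.+1%:R, (k + 1)%:~R / n.+1%:R[%classic : set R) `*`
     (f (k%:~R / n.+1%:R) @^-1` B))).
    apply: countable_bigcupT_measurable => // k.
    by apply: measurableX => //; rewrite -[X in measurable X]setTI; exact: mf.
  have n0 : (0 : R) < n.+1%:R by rewrite ltr0n.
  apply/seteqP; split => [[t y] /= Bty|[t y] [k _ [/=]]].
    exists (Num.floor (t * n.+1%:R)) => //; split => //=.
    by rewrite in_itv/= ler_pdivrMr// ltr_pdivlMr// floor_itv.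
  rewrite in_itv/= ler_pdivrMr// ltr_pdivlMr// => /floor_def.
  by rewrite /tau => ->.
move=> [t y] _ /=; apply: (@cvg_comp _ _ _ (tau^~ t) (f^~ y) \oo (nbhs t)).
  apply/cvgrPdist_le => /= e e0; near=> n.
  have n0 : (0 : R) < n.+1%:R by rewrite ltr0n.
  have /andP[tl tr] := floor_itv (t * n.+1%:R).
  rewrite ger0_norm; last by rewrite subr_ge0 ler_pdivrMr.
  rewrite lerBlDr; apply: (@le_trans _ _ (n.+1%:R^-1 + tau n t)).
    by rewrite -[X in X + _]mul1r -mulrDl ler_pdivlMr// addrC -intrD1 ltW.
  rewrite lerD2r ltW//; near: n.
  exact: (near_infty_natSinv_lt (PosNum e0)).
exact: cf.
Unshelve. all: by end_near. Qed.

(** The witness is the supremum of the times in [0, t] where [g] is nonnegative. If [g] were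
    negative there, it would be negative nearby, although such times accumulate at their
    supremum. *)
Lemma last_nonneg_time {R : realType} (g : R -> R) (t : R) : 0 <= t ->
  continuous g -> 0 <= g 0 -> g t < 0 ->
  exists2 tau, 0 <= tau < t & 0 <= g tau /\ forall s, tau < s <= t -> g s < 0.
Proof.
move=> t0 gc g0 gt.
pose S := [set s | 0 <= s <= t /\ 0 <= g s].
have S0 : S 0 by rewrite /S/= lexx t0.
have Sub : ubound S t by move=> s [/andP[]].
have supS : has_sup S by split; [exists 0|exists t].
have tau0 : 0 <= sup S by apply: ub_le_sup => //; exists t.
have taut : sup S <= t by apply: ge_sup => //; exists 0.
have gtau : 0 <= g (sup S).
  rewrite leNgt; apply/negP => gneg.
  have ng0 : 0 < - g (sup S) by rewrite oppr_gt0.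
  have /cvgrPdist_lt/(_ _ ng0)/nbhs_ballP[e /= e0 ge] := gc (sup S).
  have [s Ss /= lts] := sup_adherent e0 supS.
  have : ball (sup S) e s.
    rewrite /ball/= ger0_norm; first by rewrite ltrBlDr -ltrBlDl.
    by rewrite subr_ge0; apply: ub_le_sup => //; exists t.
  move=> /ge /=; rewrite distrC => /ltr_normlW; rewrite ltrBlDr addNr.
  by case: Ss => _; rewrite leNgt => /negP.
exists (sup S).
  rewrite tau0 lt_neqAle taut andbT; apply/eqP => E.
  by move: gtau; rewrite E leNgt gt.
split=> // s /andP[ts st]; rewrite ltNge; apply/negP => gs.
have : s <= sup S.
  apply: ub_le_sup => //; first by exists t.
  by split => //; rewrite st (le_trans tau0 (ltW ts)).
by rewrite leNgt ts.
Qed.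

(** * Measurable sets of R^d and sigma-finiteness *)

Lemma open_Rd_measurable {R : realType} {d} (U : set (Rd R d)) :
  open U -> measurable U.
Proof. by move=> oU; apply: sub_sigma_algebra. Qed.

Lemma coord_measurable {R : realType} {d} (i : 'I_d) :
  measurable_fun setT (fun x : Rd R d => x ord0 i).
Proof.
apply: (measurability _ (RGenOpens.measurableE R)) => _ [_ [a [b ->] <-]].
rewrite setTI; apply: open_Rd_measurable.
have /continuousP := @coord_continuous R 1 d ord0 i.
by apply; exact: interval_open.
Qed.

(** Measurability is meant for the product sigma-algebra, so it is derived from coordinates: two
    points differ exactly when one of their finitely many coordinates does. *)
Lemma offdiag_measurable {R : realType} {d} :
  measurable [set z : Rd R d * Rd R d | z.1 <> z.2].
Proof.
rewrite (_ : mkset _ =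
    \bigcup_(i : 'I_d) [set z : Rd R d * Rd R d | z.1 ord0 i != z.2 ord0 i]).
  apply: countable_bigcupT_measurable => // i.
  rewrite -[X in measurable X]setTI.
  have mneq : measurable_fun setT
      (fun z : Rd R d * Rd R d => ~~ (z.1 ord0 i == z.2 ord0 i)).
    apply: measurable_neg; apply: measurable_fun_eqr;
    exact: (measurableT_comp (coord_measurable i)).
  exact: (mneq measurableT [set true]).
apply/seteqP; split => z /=.
  move=> zneq; apply: contrapT => znex; apply: zneq; apply/rowP => i.
  by apply/eqP/negPn/negP => zi; apply: znex; exists i.
by case=> i _ /= /eqP zi z12; apply: zi; rewrite z12.
Qed.

Lemma graph_measurable {R : realType} {d} (eta : Rd R d -> Rd R d -> R) :
  edge_weight eta -> measurable (graph eta).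
Proof.
case=> _ meta _ _ _; rewrite /graph.
have -> : [set z : Rd R d * Rd R d | z.1 <> z.2 /\ 0 < eta z.1 z.2] =
    [set z | z.1 <> z.2] `&` (fun z => eta z.1 z.2) @^-1` `]0, +oo[%classic.
  by apply/seteqP; split => z /=; rewrite in_itv/= andbT.
by apply: meta => //; exact: offdiag_measurable.
Qed.

(** The cubes [-n, n]^d are compact, hence of finite measure, and they cover the space. *)
Lemma radon_sigma_finite {R : realType} {d} (mu : {measure set (Rd R d) -> \bar R}) :
  radon mu -> sigma_finite setT mu.
Proof.
move=> [muK _].
pose K (n : nat) := [set v : Rd R d | forall i, `[- n%:R, n%:R]%classic (v ord0 i)].
have cK n : compact (K n).
  apply: (@rV_compact R d (fun=> `[- n%:R, n%:R]%classic)) => _.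
  exact: segment_compact.
exists K.
  apply/seteqP; split => // v _.
  have [n nv] : exists n : nat, `|v : 'rV[R]_d| <= n%:R.
    exists (Num.truncn `|v : 'rV[R]_d|).+1; apply/ltW; exact: truncnS_gt.
  exists n => // i; rewrite /= in_itv/= -ler_norml (le_trans _ nv)//.
  have /mapP[j Hj ->] : `|v ord0 i| \in [seq `|v x.1 x.2| | x : 'I_1 * 'I_d].
    by apply/mapP; exists (ord0, i) => //=; rewrite mem_enum.
  by rewrite [leRHS]/Num.norm /= mx_normrE; apply/bigmax_geP; right => /=; exists j.
move=> n; split; last exact: muK.
rewrite -[K n]setCK; apply: measurableC; apply: open_Rd_measurable.
by apply: closed_openC; apply: compact_closed => //; exact: norm_hausdorff.
Qed.

(** * Integration in space and Gronwall *)

(** Gronwall is applied to the total mass of [n (t, _)]. After integration in x, one exchange brings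
    the time integral outside and another brings the x-integral onto [K], where it is at most [C]
    for each fixed y. *)
Lemma tonelli_gronwall_eq0 {R : realType} {d} {X : measurableType d}
    (mu : {sigma_finite_measure set X -> \bar R})
    (n : R * X -> \bar R) (K : R * (X * X) -> R) (T C M : R) :
  measurable_fun setT n -> (forall z, 0 <= n z)%E ->
  measurable_fun setT K -> (forall z, 0 <= K z) -> 0 < C ->
  (forall s y, \int[mu]_x (K (s, (x, y)))%:E <= C%:E)%E ->
  (forall t, 0 <= t <= T -> (\int[mu]_x n (t, x) <= M%:E)%E) ->
  (forall t, 0 <= t <= T -> {ae mu, forall x,
    (n (t, x) <= \int[lebesgue_measure]_(s in `[0%R, t])
                   \int[mu]_y (n (s, y) * (K (s, (x, y)))%:E))%E}) ->
  forall t, 0 <= t <= T -> (\int[mu]_x n (t, x) = 0)%E.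
Proof.
move=> mn n0 mK K0 C0 KC nM nint.
pose F z := (n (z.1.1, z.2) * (K (z.1.1, (z.1.2, z.2)))%:E)%E : \bar R.
have F0 z : (0 <= F z)%E by rewrite mule_ge0// lee_fin.
have mF : measurable_fun setT (F : (R * X) * X -> \bar R).
  apply: emeasurable_funM.
    apply: (measurableT_comp mn) => /=; apply: measurable_fun_pair => //.
    exact: measurableT_comp.
  apply/measurable_EFinP; apply: (measurableT_comp mK) => /=.
  apply: measurable_fun_pair; first exact: measurableT_comp.
  by apply: measurable_fun_pair => //; exact: measurableT_comp.
pose G (z : R * X) := (\int[mu]_y F (z, y))%E.
have mG : measurable_fun setT G.
  exact: (measurable_fun_fubini_tonelli_F (m2 := mu)).
have G0 z : (0 <= G z)%E by apply: integral_ge0.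
have mnt t : measurable_fun setT (fun x => n (t, x)).
  by apply: (measurableT_comp mn).
apply: (@integral_gronwall_eq0 _ _ T C M C0) => [t tT|t tT].
  by rewrite integral_ge0//= nM.
(* The interval [0, t] is moved into the integrand as an indicator, so that Tonelli applies on the
   full product. *)
pose Gt := (fun z : R * X => (\1_(`[0, t]%classic : set R) z.1)%:E * G z)%E.
have mGt : measurable_fun setT Gt.
  apply: emeasurable_funM => //; apply/measurable_EFinP.
  apply: (@measurableT_comp _ _ _ _ _ _ (\1_(`[0, t]%classic : set R) : R -> R)
    setT fst) => //.
have Gt0 z : (0 <= Gt z)%E by rewrite mule_ge0// lee_fin.
have GtE (x : X) : (\int[lebesgue_measure]_(s in `[0%R, t])
      \int[mu]_y (n (s, y) * (K (s, (x, y)))%:E) =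
    \int[lebesgue_measure]_s Gt (s, x))%E.
  rewrite integral_mkcond; apply: eq_integral => s _.
  by rewrite epatch_indic/= muleC.
apply: (@le_trans _ _ (\int[mu]_x \int[lebesgue_measure]_s Gt (s, x))%E).
  apply: ae_ge0_le_integral => //.
  - by move=> x _; exact: integral_ge0.
  - exact: (measurable_fun_fubini_tonelli_G (m1 := lebesgue_measure)).
  - have := nint t tT; apply: filterS => x + _.
    by rewrite GtE.
rewrite -(fubini_tonelli (m1 := lebesgue_measure) (m2 := mu))//.
rewrite -ge0_integralZl//; last 3 first.
- exact: measurable_funTS (measurable_fun_fubini_tonelli_F (m2 := mu) _ _ _).
- by move=> s _; exact: integral_ge0.
- by rewrite lee_fin ltW.
rewrite [leRHS]integral_mkcond; apply: ge0_le_integral_nomeas => s _.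
  exact: integral_ge0.
rewrite epatch_indic [leRHS]muleC /Gt/= ge0_integralZl//; last first.
  by apply: (measurableT_comp mG).
rewrite lee_wpmul2l// ?lee_fin//.
(* At fixed time, x and y are exchanged; [n (s, y)] then leaves the x-integral. *)
rewrite /G (fubini_tonelli (m1 := mu) (m2 := mu) (fun z => F (s, z.1, z.2)))//; last first.
  apply: (measurableT_comp mF) => /=; apply: measurable_fun_pair => //.
  exact: measurable_fun_pair.
rewrite -ge0_integralZl//; last first.
  by rewrite lee_fin ltW.
apply: ge0_le_integral_nomeas => y _; first exact: integral_ge0.
rewrite /F/= ge0_integralZl//; last 2 first.
- apply/measurable_EFinP; apply: (measurableT_comp mK) => /=.
  by apply: measurable_fun_pair => //; exact: measurable_fun_pair.
- by move=> x _; rewrite lee_fin.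
by rewrite muleC lee_wpmul2r.
Qed.

(** * Measurability of the curve in L^1 *)

(** The distance between two points of the curve is at most the increment of the primitive of [m],
    which is continuous. Hence the preimage of each generator in [L1M_open] is open in R. *)
Lemma L1_curve_measurable {R : realType} {d}
    (mu : {measure set (Rd R d) -> \bar R}) (M T : R) (rho : R -> Rd R d -> R) :
  0 <= T -> AC_L1 mu T rho -> (forall t, 0 <= t <= T -> L1M mu M (rho t)) ->
  measurable_fun setT
    (fun t => rho (clamp T t) : g_sigma_algebraType (L1M_open mu M)).
Proof.
move=> T0 [_ [m im rhom]] rhoM.
pose I := parameterized_integral lebesgue_measure 0 ^~ m.
have cI : continuous (I \o clamp T).
  by apply: within_continuous_clamp => //; exact: parameterized_integral_continuous.
have dist_lt s t : 0 <= s -> s < t -> t <= T ->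
    (L1_dist mu (rho s) (rho t) <= (I t - I s)%:E)%E.
  move=> s0 st tT; apply: (le_trans (rhom _ _ s0 st tT)).
  have t0 : 0 <= t := le_trans s0 (ltW st).
  have im0 : lebesgue_measure.-integrable `[0, t] (EFin \o m).
    by apply: integrableS im => //; exact: subset_itvl.
  have imst : lebesgue_measure.-integrable `]s, t] (EFin \o m).
    by apply: integrableS im0 => //; apply: subset_itvr; rewrite bnd_simp.
  rewrite /I /parameterized_integral Rintegral_itvB//=; last exact: ltW.
  rewrite /Rintegral fineK; last exact: integrable_fin_num.
  (* The difference of primitives gives []s, t]], the definition of [AC_L1] uses [[s, t]]; the
     endpoint is a null set. *)
  rewrite integral_itv_obnd_cbnd//.
  exact: (measurable_int lebesgue_measure).
have distC f g : L1_dist mu f g = L1_dist mu g f.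
  by apply: eq_integral => x _; rewrite distrC.
have dist_le s t : (L1_dist mu (rho (clamp T s)) (rho (clamp T t)) <=
    `|(I \o clamp T) s - (I \o clamp T) t|%:E)%E.
  have /andP[s0 sT] := clamp_itv T s T0; have /andP[t0 tT] := clamp_itv T t T0.
  have [st|ts|<-] := ltgtP (clamp T s) (clamp T t).
  - by rewrite distrC (le_trans (dist_lt _ _ _ st _))// lee_fin ler_norm.
  - by rewrite distC (le_trans (dist_lt _ _ _ ts _))// lee_fin ler_norm.
  - rewrite /L1_dist; under eq_integral do rewrite subrr normr0.
    by rewrite integral0 lee_fin.
apply: (@measurability _ _ R (g_sigma_algebraType (L1M_open mu M)) setT
  (fun t => rho (clamp T t)) (L1M_open mu M) erefl) => _ [U oU <-].
rewrite setTI; apply: open_measurable; rewrite openE => t /= Ut.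
have [e e0 Ue] := oU _ (rhoM _ (clamp_itv T t T0)) Ut.
have /cvgrPdist_lt/(_ _ e0) := cI t; apply: filterS => s ts.
apply: Ue; first exact: rhoM _ (clamp_itv T s T0).
by rewrite (le_lt_trans (dist_le t s)).
Qed.

(** * Pointwise bound on the negative part *)

Lemma neg_part_ge0 {R : realType} (a : R) : 0 <= neg_part a.
Proof. by rewrite /neg_part /pos_part le_max lexx. Qed.

Lemma neg_part_le_norm {R : realType} (a : R) : neg_part a <= `|a|.
Proof.
by rewrite /neg_part /pos_part ge_max normr_ge0 -normrN ler_norm.
Qed.

(** The term [a * pos_part w] is nonpositive, and [- b <= neg_part b]. *)
Lemma upwind_le_neg_part {R : realType} (a b w : R) : a <= 0 ->
  upwind a b w <= neg_part b * neg_part w.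
Proof.
move=> a0; have p0 (c : R) : 0 <= pos_part c by rewrite le_max lexx.
rewrite /upwind -[leRHS]add0r lerD//; first by rewrite mulr_le0_ge0.
by rewrite -mulNr ler_wpM2r ?p0// le_max lexx orbT.
Qed.

Lemma primitive_clamp_continuous {R : realType} (T : R) (v u : R -> R) (u0 : R) :
  0 <= T -> lebesgue_measure.-integrable `[0, T] (fun s => (v s)%:E) ->
  (forall t, 0 <= t <= T ->
     u t = u0 - \int[lebesgue_measure]_(s in `[0, t]) v s) ->
  continuous (u \o clamp T).
Proof.
move=> T0 iv uE.
pose I := parameterized_integral lebesgue_measure 0 ^~ v.
rewrite (_ : u \o clamp T = (fun s => u0 - (I \o clamp T) s)); last first.
  by apply/funext => s /=; rewrite uE ?clamp_itv.
move=> s; apply: cvgB; first exact: cvg_cst.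
apply: within_continuous_clamp => //.
exact: parameterized_integral_continuous.
Qed.

(** Here [u] stands for the solution at a fixed point x and [v] for its divergence. With tau the
    last time at which [u] is nonnegative, [- u t] is at most the integral of [v] over []tau, t]],
    where [u < 0] and so [v <= G]; as [G] is nonnegative, the domain can be enlarged to [0, t]. *)
Lemma neg_part_le_integral {R : realType} (T : R) (v u : R -> R) (u0 : R)
    (G : R -> \bar R) :
  0 <= u0 -> lebesgue_measure.-integrable `[0, T] (fun s => (v s)%:E) ->
  (forall t, 0 <= t <= T ->
     u t = u0 - \int[lebesgue_measure]_(s in `[0, t]) v s) ->
  (forall s, 0 <= G s)%E ->
  (forall s, 0 <= s <= T -> u s < 0 -> ((v s)%:E <= G s)%E) ->
  forall t, 0 <= t <= T ->
    ((neg_part (u t))%:E <= \int[lebesgue_measure]_(s in `[0%R, t]) G s)%E.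
Proof.
move=> u0_ge0 iv uE G0 vG t /[dup] tT /andP[t0 tT'].
have [ut|ut] := leP 0 (u t).
  by rewrite /neg_part /pos_part max_l ?oppr_le0// integral_ge0.
have T0 : 0 <= T by exact: le_trans tT'.
have cu := primitive_clamp_continuous T v u u0 T0 iv uE.
have [||tau /andP[tau0 taut] [utau uneg]] := last_nonneg_time _ _ t0 cu.
- rewrite /= clamp_id ?lexx// uE ?lexx//.
  by rewrite set_itv1 Rintegral_set1 subr0.
- by rewrite /= clamp_id.
have tauT : 0 <= tau <= T by rewrite tau0 (le_trans (ltW taut)).
rewrite /= clamp_id// in utau.
have iv' : lebesgue_measure.-integrable `[0, t] (EFin \o v).
  by apply: integrableS iv => //; exact: subset_itvl.
have utE : u t = u tau - \int[lebesgue_measure]_(s in `]tau, t]) v s.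
  rewrite !uE// -(@Rintegral_itvB _ v (BLeft 0) (BRight t) tau)//=.
    by rewrite opprB addrA addrNK.
  by rewrite bnd_simp ltW.
rewrite /neg_part /pos_part max_r ?oppr_ge0 ?(ltW ut)//.
apply: (@le_trans _ _ (\int[lebesgue_measure]_(s in `]tau, t]) v s)%:E).
  by rewrite lee_fin utE opprB lerBlDr lerDl.
rewrite /Rintegral fineK; last first.
  apply: integrable_fin_num => //; apply: integrableS iv' => //.
  by apply: subset_itvr; rewrite bnd_simp.
apply: (@le_trans _ _ (\int[lebesgue_measure]_(s in `]tau, t]) G s)%E).
  apply: le_integral_ge0_nomeas => // s /=; rewrite in_itv/= => /andP[s1 s2].
  have sT : 0 <= s <= T by rewrite (le_trans tau0 (ltW s1)) (le_trans s2).
  apply: vG => //; have := uneg s; rewrite /= clamp_id//; apply.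
  by rewrite s1.
rewrite integral_mkcond [leRHS]integral_mkcond.
apply: ge0_le_integral_nomeas => s _; first exact: erestrict_ge0.
rewrite !patchE; case: ifPn => [|_]; last by case: ifPn.
rewrite inE/= in_itv/= => /andP[s1 s2]; rewrite ifT// inE/= in_itv/= s2.
by rewrite (le_trans tau0 (ltW s1)).
Qed.

(** * Nonnegativity of the solution *)

Theorem proposition5p2 (R : realType) (d : nat)
    (mu : {measure set (Rd R d) -> \bar R}) (mu_radon : radon mu)
    (eta : Rd R d -> Rd R d -> R) (eta_weight : edge_weight eta)
    (T M : R) (T_gt0 : 0 < T) (M_gt0 : 0 < M)
    (rho0 : Rd R d -> R) (rho0_L1M : L1M mu M rho0)
    (rho0_ge0 : forall x, 0 <= rho0 x)
    (V : R -> (Rd R d -> R) -> Rd R d -> Rd R d -> R)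
    (V_as : forall (t : R) f, 0 <= t <= T -> L1M mu M f ->
       antisymmetric_on_graph eta (V t f))
    (V_meas : measurable_velocity mu eta M T V)
    (CV LV : R) (CV_gt0 : 0 < CV) (LV_gt0 : 0 < LV)
    (V_bounded : forall (t : R) f (x : Rd R d), 0 <= t <= T -> L1M mu M f ->
       (\int[mu]_(y in ~` [set x]) (`|V t f x y| * eta x y)%:E <= CV%:E)%E)
    (V_lipschitz : forall (t : R) f g (x : Rd R d), 0 <= t <= T -> L1M mu M f -> L1M mu M g ->
       (\int[mu]_(y in ~` [set x]) (`|V t f x y - V t g x y| * eta x y)%:E
          <= LV%:E * L1_dist mu f g)%E)
    (rho : R -> Rd R d -> R)
    (rho_sol : solution (@upwind R) mu eta M T V rho0 rho) :
  {ae lebesgue_measure, forall t : R, 0 <= t <= T ->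
     {ae mu, forall x, 0 <= rho t x}}.
Proof.
(* [N] is a measurable null set, the same for all times, off which the integral equation holds. *)
have [rhoAC rhoM [N [mN muN rhoN]]] := rho_sol.
have [eta_ge0 meta _ _ eta_sym] := eta_weight.
have T_ge0 := ltW T_gt0.
have {}rhoN x : x \notin N ->
    lebesgue_measure.-integrable `[0, T] (fun s => (nonlocal_divergence
      (@upwind R) mu eta (rho s) (V s (rho s)) x)%:E) /\
    forall t, 0 <= t <= T -> rho t x = rho0 x -
      \int[lebesgue_measure]_(s in `[0, t])
        nonlocal_divergence (@upwind R) mu eta (rho s) (V s (rho s)) x.
  move=> xN; apply: contrapT => xrho; move/negP: xN; apply.
  by rewrite inE; exact: rhoN.
(* Tonelli requires a sigma-finite measure: [nu] is [mu] equipped with that structure. *)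
have sf := radon_sigma_finite mu mu_radon.
pose sfinite_mu := isSFinite.Build _ _ _ mu (sfinite_measure_sigma_finite sf).
pose sigma_finite_mu := isSigmaFinite.Build _ _ _ mu sf.
pose nu := HB.pack_for {sigma_finite_measure set (Rd R d) -> \bar R}
  (Measure.sort mu) sfinite_mu sigma_finite_mu.
pose r t := rho (clamp T t).
have rM t : L1M mu M (r t) by apply: rhoM; rewrite clamp_itv.
have mrt t : measurable_fun setT (r t).
  by have [/measurable_int/measurable_EFinP] := rM t.
(* Replacing the values on [N] by 0 makes every time section continuous, as the Carathéodory lemma
   demands. *)
have mr : measurable_fun setT (fun z : R * Rd R d => (r z.1 \_ (~` N)) z.2).
  apply: (caratheodory_measurable_fun (fun t => r t \_ (~` N))) => [t|y].
    apply/(measurable_restrictT _ (measurableC mN)).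
    exact: measurable_funTS.
  have [yN|yN] := boolP (y \in N).
    rewrite (_ : (fun _ => _) = cst 0); first exact: cst_continuous.
    by apply/funext => t; rewrite patchE in_setC yN.
  have [iv uE] := rhoN y yN.
  rewrite (_ : (fun _ => _) = rho ^~ y \o clamp T).
    exact: primitive_clamp_continuous iv uE.
  by apply/funext => t; rewrite patchE in_setC yN.
(* The value +oo on the exceptional set N makes n bound the negative part of r
   everywhere, so that the sections y |-> n (s, y) need no a.e. argument. *)
pose n (z : R * Rd R d) : \bar R :=
  if z.2 \in N then +oo%E else (neg_part ((r z.1 \_ (~` N)) z.2))%:E.
have nE t y : y \notin N -> n (t, y) = (neg_part (rho (clamp T t) y))%:E.
  by move=> yN; rewrite /n/= (negbTE yN) patchE in_setC yN.
have le_n t y : ((neg_part (r t y))%:E <= n (t, y))%E.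
  by have [yN|/nE ->//] := boolP (y \in N); rewrite /n/= yN leey.
have n_ge0 z : (0 <= n z)%E.
  by case: z => t y; apply: le_trans (le_n t y); rewrite lee_fin neg_part_ge0.
have mneg (dY : measure_display) (Y : measurableType dY) (D : set Y) (f : Y -> R) :
    measurable_fun D f -> measurable_fun D (fun y => neg_part (f y)).
  by move=> mf; apply: measurable_maxr => //; exact: measurable_funN.
have mn : measurable_fun setT n.
  apply: measurable_fun_ifT => //.
    apply: (@measurable_fun_bool _ _ _ _ true); rewrite setTI.
    rewrite (_ : _ @^-1` _ = snd @^-1` N).
      by rewrite -[X in measurable X]setTI; exact: measurable_snd.
    by apply/seteqP; split => z /= => [/set_mem|/mem_set].
  by apply/measurable_EFinP; exact: mneg.
(* The values of [V] and [eta] outside the graph are arbitrary, so the kernel is set to 0 there. *)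
pose K := (fun z : R * (Rd R d * Rd R d) =>
  neg_part (V (clamp T z.1) (r z.1) z.2.1 z.2.2) * eta z.2.1 z.2.2)
    \_ (setT `*` graph eta).
have mG := graph_measurable eta eta_weight.
have mTG : measurable ([set: R] `*` graph eta) by exact: measurableX.
have K_ge0 z : 0 <= K z.
  rewrite /K patchE; case: ifPn => //; rewrite inE/= => -[_ [_ /= eta0]].
  by rewrite mulr_ge0 ?neg_part_ge0// ltW.
have nK_ge0 s x y : (0 <= n (s, y) * (K (s, (x, y)))%:E)%E.
  by apply: mule_ge0 => //; rewrite lee_fin.
have mK : measurable_fun setT K.
  apply/(measurable_restrictT _ mTG); apply: measurable_funM; last first.
    apply: (measurable_comp mG (f := fun z => eta z.1 z.2) (g := snd)).
    - by move=> _ [z [_ Gz] <-].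
    - by apply: measurable_funS meta => [|z []//]; exact: offdiag_measurable.
    - exact: measurable_funTS.
  apply: mneg.
  pose L1 : set (g_sigma_algebraType (L1M_open mu M)) := L1M mu M.
  apply: (measurable_comp (F := (`[0, T] `*` L1) `*` graph eta)
    (f := fun z => V z.1.1 z.1.2 z.2.1 z.2.2)
    (g := fun z => ((clamp T z.1, r z.1), z.2))).
  - apply: measurableX => //; apply: measurableX => //.
    (* [L1M mu M] is itself a generator: any radius serves, here 1. *)
    by apply: sub_sigma_algebra => f _ fM; exists 1 => // g gM _.
  - move=> _ [z [_ Gz] <-]; split => //; split => /=; last exact: rM.
    by rewrite in_itv/= clamp_itv.
  - exact: V_meas.
  - apply: measurable_funTS; apply: measurable_fun_pair => //.
    apply: measurable_fun_pair.
      apply: measurableT_comp => //; apply: continuous_measurable_fun.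
      exact: clamp_continuous.
    by apply: (measurableT_comp (L1_curve_measurable mu M T rho T_ge0 rhoAC rhoM)).
have KV s y : (\int[mu]_x (K (s, (x, y)))%:E <= CV%:E)%E.
  (* The integral runs over the first argument of [V], the assumed bound over the second. The bound
     is taken at base point y, and antisymmetry of [V] with symmetry of [eta] swaps the
     arguments. *)
  apply: le_trans (V_bounded (clamp T s) (r s) y (clamp_itv T s T_ge0) (rM s)).
  rewrite [leRHS]integral_mkcond; apply: ge0_le_integral_nomeas => x _.
    by rewrite lee_fin.
  rewrite /K !patchE; case: ifPn => [|_].
    rewrite inE/= => -[_ xy]; have [/= xDy eta0] := xy.
    rewrite ifT; last by rewrite inE/= => xE; apply: xDy.
    have yx : V (clamp T s) (r s) y x = - V (clamp T s) (r s) x y.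
      by apply: (V_as _ _ _ (rM s)) => //; rewrite clamp_itv.
    rewrite (eta_sym _ _ xy) lee_fin (ler_wpM2r (ltW eta0))//.
    by rewrite yx normrN neg_part_le_norm.
  case: ifPn => //; rewrite inE/= => xy.
  by rewrite lee_fin mulr_ge0// eta_ge0// => yx; apply: xy.
have n_int t x : x \notin N -> 0 <= t <= T ->
    (n (t, x) <= \int[lebesgue_measure]_(s in `[0%R, t])
                   \int[mu]_y (n (s, y) * (K (s, (x, y)))%:E))%E.
  move=> xN tT; have [iv uE] := rhoN x xN.
  rewrite nE// clamp_id//; apply: neg_part_le_integral iv uE _ _ _ tT => //.
    by move=> s; apply: integral_ge0 => y _; rewrite nK_ge0.
  move=> s sT rhox; rewrite /nonlocal_divergence /Rintegral.
  set I := (X in fine X); set J := (X in (_ <= X)%E).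
  have J_ge0 : (0 <= J)%E by apply: integral_ge0 => y _; rewrite nK_ge0.
  (* If I is infinite then fine I = 0, which is still at most J. *)
  suff IJ : (I <= J)%E by move: IJ; case: I => [?| |].
  rewrite /I integral_mkcond; apply: le_integral_ge0_nomeas => y _.
    by rewrite nK_ge0.
  rewrite patchE; case: ifPn => [|_]; last by rewrite nK_ge0.
  rewrite inE/= => yx.
  (* Either [eta x y] is 0 and the flux vanishes, or (x, y) lies in the graph and [K] is given by
     its formula. *)
  have := eta_ge0 x y (fun xy => yx (esym xy)).
  rewrite le_eqVlt => /predU1P[<-|eta0].
    by rewrite mulr0 nK_ge0.
  apply: (@le_trans _ _ ((neg_part (r s y))%:E * (K (s, (x, y)))%:E)%E); last first.
    by rewrite lee_wpmul2r ?lee_fin.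
  rewrite /K patchE ifT/=; last first.
    by rewrite inE/=; split => //; split => //= xy; apply: yx.
  rewrite /r clamp_id// -EFinM lee_fin mulrA ler_wpM2r ?(ltW eta0)//.
  by rewrite upwind_le_neg_part// ltW.
have mnt t : measurable_fun setT (fun x => n (t, x)).
  exact: (measurableT_comp mn).
have n_le t : (\int[mu]_x n (t, x) <= M%:E)%E.
  (* The value +oo is taken only on the null set [N]; elsewhere [n] is at most the absolute value of
     [r t], whose integral is [M]. *)
  have [irt <-] := rM t; apply: ae_ge0_le_integral => //.
  - by apply/measurable_EFinP; exact: measurableT_comp.
  - exists N; split => // x /=; apply: contra_notP => xN _.
    have {}xN : x \notin N by apply/negP; rewrite inE.
    rewrite nE// lee_fin; exact: neg_part_le_norm.
(* The conclusion is reached at every time of [0, T]. *)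
apply: aeW => t tT.
have int0 : (\int[mu]_x n (t, x) = 0)%E.
  apply: (tonelli_gronwall_eq0 nu n K T CV M) => // s sT.
  exists N; split => // x /=; apply: contra_notP => xN; apply: n_int => //.
  by apply/negP; rewrite inE.
have : ae_eq mu setT (fun x => n (t, x)) (cst 0%E).
  apply/ae_eq_integral_abs => //.
  by under eq_integral do rewrite gee0_abs//.
apply: filterS => x /(_ Logic.I) /= nx0.
have := le_n t x; rewrite nx0 lee_fin /r clamp_id// /neg_part /pos_part ge_max.
by rewrite oppr_le0 => /andP[].
Qed.
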